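(* Let $F$ be an RS-fan and let $I\subseteq J$ be (proper) ideals of $F$. Then: (1) The rule $a/J\mapsto a/I$ ($a\in F\setminus J$) defines a homomorphism of special groups $\iota_{JI}:F_J\to F_I$. (2) The map $\kappa_{IJ}:L_I(F)\to L_J(F)$ assigning to each $g\in L_I(F)$ the unique element $h\in L_J(F)$ such that $g\rightsquigarrow h$ is an AOS-morphism.
   Context: A ternary semigroup (TS) is a commutative monoid $(T,\cdot,1)$ with distinguished elements $0,-1$ such that, for all $x$: $x^3=x$; $x\cdot 0=0$; $-1\neq 1$ and $(-1)(-1)=1$; and $x=-x$ implies $x=0$ (where $-x:=(-1)\cdot x$). $\mathbf 3=\{1,0,-1\}$ with the usual multiplication is a TS. A real semigroup (RS) is a TS $G$ with a ternary relation ''$a\in D(b,c)$'' such that, writing $a\in D^t(b,c)$ for [$a\in D(b,c)$ and $-b\in D(-a,c)$ and $-c\in D(b,-a)$], for all $a,b,c,d,e\in G$: (RS0) $c\in D(a,b)\Leftrightarrow c\in D(b,a)$; (RS1) $a\in D(a,b)$; (RS2) $a\in D(b,c)\Rightarrow ad\in D(bd,cd)$; (RS3) $a\in D^t(b,c)$ and $c\in D^t(d,e)$ imply there is $x\in D^t(b,d)$ with $a\in D^t(x,e)$; (RS4) $e\in D(c^2a,d^2b)\Rightarrow e\in D(a,b)$; (RS5) $ad=bd$, $ae=be$, $c\in D(d,e)\Rightarrow ac=bc$; (RS6) $c\in D(a,b)\Rightarrow c\in D^t(c^2a,c^2b)$; (RS7) $D^t(a,-b)\cap D^t(b,-a)\neq\emptyset\Rightarrow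 a=b$; (RS8) $a\in D(b,c)\Rightarrow a^2\in D(b^2,c^2)$. Characters: $X_G$ is the set of maps $h:G\to\mathbf 3$ preserving product, $1,0,-1$, and such that $c\in D(a,b)$ implies $h(c)\in\{0,h(a),h(b)\}$. (Known duality: $c\in D(a,b)$ iff $h(c)\in\{0,h(a),h(b)\}$ for all $h\in X_G$, and $X_G$ separates points of $G$.) Products of characters are pointwise; $Z(h):=h^{-1}[0]$. Specialization: $g\rightsquigarrow h$ iff $h^{-1}[1]\subseteq g^{-1}[1]$ (equivalently $h^2=hg$). An RS-fan is an RS $F$ such that $X_F$ is closed under products of any three of its elements. An ideal of $F$ is a nonempty $I\subseteq F$ with $F\cdot I\subseteq I$; $\mathrm{Spec}(F)$ is the set of proper ideals. Known facts for an RS-fan $F$: every TS-homomorphism $F\to\mathbf 3$ lies in $X_F$; proper ideals are prime and saturated, and are totally ordered by inclusion; each is $Z(f)$ for some $f\in X_F$; for $g\in X_F$ and a proper ideal $I\supseteq Z(g)$ there is a unique $f\in X_F$ with $g\rightsquigarrow f$ and $Z(f)=I$. Levels: for $I\in\mathrm{Spec}(F)$, $L_I=L_I(F)=\{h\in X_F: Z(h)=I\}$. Put $a\sim_I b$ iff $h(a)=h(b)$ for all $h\in L_I$; $a/I$ denotes the class of $a$; $F_I:=(F/{\sim_I})\setminus\{0/I\}=\{a/I: a\notin I\}$, a group of exponent 2 with distinguished element $-1=-1/I$. It is a fan as a reduced special group (RSG-fan): representation is $D(x,y)=\{x,y\}$ if $y\neq -x$, and $D(x,-x)=F_I$. A homomorphism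 of special groups is a group homomorphism preserving $-1$ and representation ($z\in D(x,y)\Rightarrow f(z)\in D(f(x),f(y))$). Each $h\in L_I$ induces $\widehat h:F_I\to\{\pm1\}$, $\widehat h(a/I)=h(a)$, and $h\mapsto\widehat h$ identifies $L_I$ with the set of all group characters $F_I\to\{\pm1\}$ sending $-1$ to $-1$; thus $(L_I,F_I)$ is an abstract order space (AOS), in fact an AOS-fan. An AOS-morphism $(X,G)\to(Y,H)$ is a map $\Phi:X\to Y$ such that for every $a\in H$ there is $b\in G$ with $\widehat a\circ\Phi=\widehat b$, where $\widehat a$ denotes evaluation at $a$. *)

(* Defs.v *)
From HB Require Import structures.
Set Warnings "-notation-overridden,-redundant-canonical-projection".
From mathcomp Require Import all_boot.
From mathcomp Require Import boolp classical_sets.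

Set Implicit Arguments.
Unset Strict Implicit.
Unset Printing Implicit Defensive.

Declare Scope ts_scope.
Delimit Scope ts_scope with ts.
Local Open Scope classical_set_scope.
Local Open Scope group_scope.
Local Open Scope ts_scope.

(* [choiceType], which [monoidType] requires, is no restriction: by the
   classical axioms of [boolp], every type carries such a structure. *)
HB.mixin Record Monoid_isTernarySemigroup T of Monoid T := {
  ts_zero : T;
  ts_negone : T;
  ts_mulC : forall x y : T, x * y = y * x;
  ts_cube : forall x : T, x ^+ 3 = x;
  ts_mul0 : forall x : T, x * ts_zero = ts_zero;
  ts_negone_neq1 : ts_negone <> 1;
  ts_negone_sq : ts_negone * ts_negone = 1;
  ts_opp_fix : forall x : T, x = ts_negone * x -> x = ts_zero
}.

#[short(type="tsType")]
HB.structure Definition TernarySemigroup :=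
  {T of Monoid_isTernarySemigroup T & Monoid T}.

Definition ts_opp (T : tsType) (x : T) : T := ts_negone * x.

Notation "0" := (@ts_zero _) : ts_scope.
Notation "-1" := (@ts_negone _) : ts_scope.
Notation "- x" := (ts_opp x) : ts_scope.

Inductive three := One | Zero | NegOne.

HB.instance Definition _ := gen_eqMixin three.
HB.instance Definition _ := gen_choiceMixin three.

Definition three_mul (x y : three) : three :=
  match x, y with
  | Zero, _ | _, Zero => Zero
  | One, One | NegOne, NegOne => One
  | One, NegOne | NegOne, One => NegOne
  end.

Fact three_mulA : associative three_mul.
Proof. by case=> -[] []. Qed.

Fact three_mul1 : left_id One three_mul.
Proof. by case. Qed.

Fact three_mulC : commutative three_mul.
Proof. by case=> -[]. Qed.

Fact three_1mul : right_id One three_mul.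
Proof. by case. Qed.

HB.instance Definition _ :=
  isMonoid.Build three three_mulA three_mul1 three_1mul.

Fact three_cube (x : three) : x ^+ 3 = x.
Proof. by case: x. Qed.

Fact three_mul0 (x : three) : x * Zero = Zero.
Proof. by case: x. Qed.

Fact three_opp_fix (x : three) : x = NegOne * x -> x = Zero.
Proof. by case: x. Qed.

Fact three_negone_neq1 : NegOne <> 1 :> three.
Proof. by []. Qed.

Fact three_negone_sq : NegOne * NegOne = 1 :> three.
Proof. by []. Qed.

HB.instance Definition _ :=
  Monoid_isTernarySemigroup.Build three three_mulC three_cube three_mul0
    three_negone_neq1 three_negone_sq three_opp_fix.

(* "a in D(b,c)" is encoded as [D b c a]; see [rs_rep] below. *)
Definition transversal (T : tsType) (D : T -> T -> set T) (b c : T) : set T :=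
  [set a | [/\ D b c a, D (- a) c (- b) & D b (- a) (- c)]].

HB.mixin Record TernarySemigroup_isRealSemigroup G of TernarySemigroup G := {
  rs_rep : G -> G -> set G;
  rs0 : forall a b c : G, rs_rep a b c <-> rs_rep b a c;
  rs1 : forall a b : G, rs_rep a b a;
  rs2 : forall a b c d : G, rs_rep b c a -> rs_rep (b * d) (c * d) (a * d);
  rs3 : forall a b c d e : G,
    transversal rs_rep b c a -> transversal rs_rep d e c ->
    exists2 x, transversal rs_rep b d x & transversal rs_rep x e a;
  rs4 : forall a b c d e : G,
    rs_rep (c ^+ 2 * a) (d ^+ 2 * b) e -> rs_rep a b e;
  rs5 : forall a b c d e : G,
    a * d = b * d -> a * e = b * e -> rs_rep d e c -> a * c = b * c;
  rs6 : forall a b c : G,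
    rs_rep a b c -> transversal rs_rep (c ^+ 2 * a) (c ^+ 2 * b) c;
  rs7 : forall a b : G,
    transversal rs_rep a (- b) `&` transversal rs_rep b (- a) !=set0 -> a = b;
  rs8 : forall a b c : G, rs_rep b c a -> rs_rep (b ^+ 2) (c ^+ 2) (a ^+ 2)
}.

#[short(type="rsType")]
HB.structure Definition RealSemigroup :=
  {G of TernarySemigroup_isRealSemigroup G & TernarySemigroup G}.

Definition characters (G : rsType) : set (G -> three) :=
  [set h | [/\ forall a b, h (a * b) = h a * h b,
               h 1 = 1, h 0 = 0, h (-1) = -1
             & forall a b c, rs_rep a b c -> [\/ h c = 0, h c = h a | h c = h b]]].
Arguments characters : clear implicits.

Definition zero_set (G : Type) (h : G -> three) : set G := h @^-1` [set 0].

Definition specializes (G : Type) (g h : G -> three) : Prop :=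
  h @^-1` [set 1] `<=` g @^-1` [set 1].

Notation "g ~~> h" := (specializes g h) (at level 70, no associativity).

Definition is_fan (F : rsType) : Prop :=
  forall h1 h2 h3 : F -> three,
    characters F h1 -> characters F h2 -> characters F h3 ->
    characters F (fun a => h1 a * h2 a * h3 a).

Definition is_ideal (F : rsType) (I : set F) : Prop :=
  I !=set0 /\ forall a x, I x -> I (a * x).

Definition Spec (F : rsType) : set (set F) :=
  [set I | is_ideal I /\ I <> setT].
Arguments Spec : clear implicits.

(* The signature over which special groups and their homomorphisms are defined:
   a group of exponent 2 with a distinguished element -1 and a representation
   relation, [sg_rep x y z] standing for "z in D(x,y)".  The other axioms of
   special groups do not enter into the notion of homomorphism and are not
   imposed here. *)
HB.mixin Record Group_isSGStructure G of Group G := {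
  sg_exp2 : forall x : G, x * x = 1;
  sg_negone : G;
  sg_rep : G -> G -> set G
}.

#[short(type="sgStructType")]
HB.structure Definition SGStructure := {G of Group_isSGStructure G & Group G}.

Definition sg_homomorphism (G H : sgStructType) (f : G -> H) : Prop :=
  [/\ forall x y, f (x * y) = f x * f y,
      f sg_negone = sg_negone
    & forall x y z, sg_rep x y z -> sg_rep (f x) (f y) (f z)].

Definition fan_rep (G : Group.type) (m : G) (x y : G) : set G :=
  [set z | y <> m * x -> z = x \/ z = y].

(* The data (X, G) of an abstract order space: [X] is a set of group characters
   G -> {1,-1} sending -1 to -1 and separating the points of [G].  The other
   axioms of abstract order spaces do not enter into the notion of morphism and
   are not imposed here. *)
Record sign_space := SignSpace {
  points : Type;
  sign_group : sgStructType;
  sign : points -> sign_group -> three;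
  sign_neq0 : forall x a, sign x a <> 0;
  sign_mul : forall x a b, sign x (a * b) = sign x a * sign x b;
  sign_negone : forall x, sign x sg_negone = -1;
  sign_inj : injective sign;
  sign_sep : forall a b, (forall x, sign x a = sign x b) -> a = b
}.

Definition aos_morphism (S T : sign_space) (Phi : points S -> points T) : Prop :=
  forall a : sign_group T, exists b : sign_group S,
    forall x, sign (Phi x) a = sign x b.

Section Levels.
Variables (F : rsType).
Implicit Types (I : Spec F) (a b : F).

Definition level I : set (F -> three) :=
  [set h | characters F h /\ zero_set h = sval I].

Definition level_equiv I a b : Prop := forall h, level I h -> h a = h b.

Definition level_class I a : set F := [set b | level_equiv I a b].

Definition level_classes I : set (set F) :=
  [set C | exists2 a, ~ sval I a & C = level_class I a].

(* F_I as the set of all classes a/I with a outside I.  If [level I] is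
   nonempty, this is the same as the quotient of F with 0/I removed: a
   character in [level I] vanishes exactly on I. *)
Definition level_group I : Type := level_classes I.

HB.instance Definition _ I := Choice.on (level_group I).

Definition level_inj I a (aI : ~ sval I a) : level_group I :=
  SigSub (mem_set (ex_intro2 _ _ a aI erefl : level_classes I (level_class I a))).

Definition level_repr I (x : level_group I) : F :=
  projT1 (cid2 (set_mem (svalP x))).

Lemma level_classP I a b : level_class I a = level_class I b <-> level_equiv I a b.
Proof.
split=> [e h hI|ab].
  have : level_class I b b by [].
  by rewrite -e => /(_ h hI).
by apply/seteqP; split=> c /= + h hI => /(_ h hI) <-; rewrite (ab h hI).
Qed.

Lemma level_inj_eq I a b (aI : ~ sval I a) (bI : ~ sval I b) :
  level_inj aI = level_inj bI <-> level_equiv I a b.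
Proof.
rewrite -level_classP; split=> [/(congr1 val)//|e].
exact/val_inj.
Qed.

Lemma level_reprN I (x : level_group I) : ~ sval I (level_repr x).
Proof. by rewrite /level_repr; case: cid2. Qed.

Lemma level_reprK I (x : level_group I) : level_inj (@level_reprN I x) = x.
Proof. by apply/val_inj => /=; rewrite /level_repr; case: cid2. Qed.

Lemma level_inj_reprE I a (aI : ~ sval I a) :
  level_equiv I (level_repr (level_inj aI)) a.
Proof. by apply/level_classP; rewrite /level_repr; case: cid2 => b bI /= <-. Qed.

Lemma spec_ideal I a b : sval I b -> sval I (a * b).
Proof. by case: (set_mem (svalP I)) => -[_ +] _; exact. Qed.

Lemma spec1N I : ~ sval I 1.
Proof.
move=> I1; case: (set_mem (svalP I)) => _; apply; apply/seteqP; split=> // a _.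
by rewrite -[a]mulg1; apply: spec_ideal.
Qed.

Lemma spec_negoneN I : ~ sval I (-1).
Proof. by move=> /(spec_ideal (-1)); rewrite ts_negone_sq => /spec1N. Qed.

Lemma levelN0 I h a : level I h -> h a <> 0 <-> ~ sval I a.
Proof. by case=> _ <-. Qed.

Lemma level_mul I h a b : level I h -> h (a * b) = h a * h b.
Proof. by case=> -[+ _ _ _ _] _; exact. Qed.

Lemma level1 I h : level I h -> h 1 = 1.
Proof. by case=> -[]. Qed.

Lemma level_negone I h : level I h -> h (-1) = -1.
Proof. by case=> -[]. Qed.

Lemma level_mul_subproof I a b : ~ sval I a -> ~ sval I b ->
  level_classes I (level_class I (a * b)).
Proof.
move=> aI bI; have [[h hI]|L0] := pselect (level I !=set0).
  exists (a * b) => //; apply/(levelN0 _ hI); rewrite (level_mul _ _ hI).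
  by move/(levelN0 _ hI): aI; move/(levelN0 _ hI): bI; case: (h a); case: (h b).
exists 1; first exact: spec1N.
by apply/level_classP => h hI; case: L0; exists h.
Qed.

Definition level_one I : level_group I := level_inj (@spec1N I).

Definition level_mulg I (x y : level_group I) : level_group I :=
  SigSub (mem_set (level_mul_subproof (@level_reprN I x) (@level_reprN I y))).

Definition level_sign I (h : level I) (x : level_group I) : three :=
  sval h (level_repr x).

Lemma level_signE I (h : level I) a (aI : ~ sval I a) :
  level_sign h (level_inj aI) = sval h a.
Proof. exact: (level_inj_reprE aI (set_mem (svalP h))). Qed.

Lemma level_sign_neq0 I (h : level I) x : level_sign h x <> 0.
Proof. exact/(levelN0 _ (set_mem (svalP h)))/level_reprN. Qed.

Lemma level_sign_mul I (h : level I) x y :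
  level_sign h (level_mulg x y) = level_sign h x * level_sign h y.
Proof.
rewrite /level_sign -(level_mul _ _ (set_mem (svalP h))).
set z := level_mulg x y.
have : level_class I (level_repr z) = level_class I (level_repr x * level_repr y).
  by rewrite -[RHS]/(val z) -[in RHS](level_reprK z).
by move/level_classP => /(_ _ (set_mem (svalP h))).
Qed.

Lemma level_sign1 I (h : level I) : level_sign h (level_one I) = 1.
Proof. by rewrite level_signE (level1 (set_mem (svalP h))). Qed.

Lemma level_sign_sep I (x y : level_group I) :
  (forall h : level I, level_sign h x = level_sign h y) -> x = y.
Proof.
move=> e; rewrite -(level_reprK x) -(level_reprK y); apply/level_inj_eq => h hI.
exact: (e (SigSub (mem_set hI))).
Qed.

Fact level_mulA I : associative (@level_mulg I).
Proof.
by move=> x y z; apply: level_sign_sep => h; rewrite !level_sign_mul mulgA.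
Qed.

Fact level_mul1 I : left_id (level_one I) (@level_mulg I).
Proof.
by move=> x; apply: level_sign_sep => h; rewrite level_sign_mul level_sign1 mul1g.
Qed.

Fact level_1mul I : right_id (level_one I) (@level_mulg I).
Proof.
by move=> x; apply: level_sign_sep => h; rewrite level_sign_mul level_sign1 mulg1.
Qed.

Fact level_exp2 I (x : level_group I) : level_mulg x x = level_one I.
Proof.
apply: level_sign_sep => h; rewrite level_sign_mul level_sign1.
by have := @level_sign_neq0 I h x; case: (level_sign h x).
Qed.

HB.instance Definition _ I := isGroup.Build (level_group I)
  (@level_mulA I) (@level_mul1 I) (@level_1mul I) (@level_exp2 I) (@level_exp2 I).

Definition level_negoneg I : level_group I := level_inj (@spec_negoneN I).

HB.instance Definition _ I := Group_isSGStructure.Build (level_group I)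
  (@level_exp2 I) (level_negoneg I) (fan_rep (level_negoneg I)).

Lemma level_inj_mul I a b (aI : ~ sval I a) (bI : ~ sval I b)
    (abI : ~ sval I (a * b)) :
  level_inj aI * level_inj bI = level_inj abI.
Proof.
apply: level_sign_sep => h; rewrite level_sign_mul !level_signE.
by rewrite (level_mul _ _ (set_mem (svalP h))).
Qed.

Lemma level_sign_negone I (h : level I) : level_sign h sg_negone = -1.
Proof. by rewrite level_signE (level_negone (set_mem (svalP h))). Qed.

Lemma level_sign_inj I : injective (@level_sign I).
Proof.
move=> g h e; apply/val_inj/funext => a.
have [gI hI] := (set_mem (svalP g), set_mem (svalP h)).
have [aI|aI] := pselect (sval I a); last first.
  by have := congr1 (fun s => s (level_inj aI)) e; rewrite !level_signE.
have zeroE k : level I k -> k a = 0 by move=> kI; move: aI; rewrite -kI.2.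
by rewrite /= (zeroE _ gI) (zeroE _ hI).
Qed.

Definition level_space I : sign_space :=
  SignSpace (@level_sign_neq0 I) (@level_sign_mul I) (@level_sign_negone I)
    (@level_sign_inj I) (@level_sign_sep I).

End Levels.

(* Main.v *)
Require Import Defs.
Set Warnings "-notation-overridden,-redundant-canonical-projection".
From HB Require Import structures.
From mathcomp Require Import all_boot.
From mathcomp Require Import boolp classical_sets.

Local Open Scope classical_set_scope.

(* Everything rests on the separation of points by characters.  As in real
   algebra, a saturated subset T (one containing the squares and stable under
   product and representation) maximal among those omitting - s, with s
   idempotent, is the nonnegative part of a character equal to 1 at s; RS5 and
   RS7 show that distinct elements are told apart in this way.
   In a fan, products of three separating characters then force
   x^2 y^2 = x^2 or x^2 y^2 = y^2, hence proper ideals are prime, and determine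
   representation so tightly that every multiplicative map F -> 3 is a
   character.  So for g in L_I the map equal to g off J and to 0 on J is a
   character: this is kappa(g), and g(a) = kappa(g)(a) for a outside J yields
   both claims. *)

(** * Arithmetic of ternary semigroups *)

Section TernarySemigroupTheory.
Local Open Scope group_scope.
Local Open Scope ts_scope.
Context {G : tsType}.
Implicit Types x y : G.

HB.instance Definition _ :=
  SemiGroup.isComLaw.Build G *%g (@mulgA G) (@ts_mulC G).

Lemma ts_cubeE x : x * x * x = x.
Proof. by rewrite -mulgA; exact: ts_cube. Qed.

Lemma ts_sqK x y : x * x * (x * y) = x * y.
Proof. by rewrite mulgA ts_cubeE. Qed.

Lemma ts_sq_idem x : x * x * (x * x) = x * x.
Proof. exact: ts_sqK. Qed.

Lemma ts_0mul x : 0 * x = 0.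
Proof. by rewrite ts_mulC ts_mul0. Qed.

Lemma ts_mulN x y : x * (- y) = - (x * y).
Proof. by rewrite /ts_opp !mulgA (ts_mulC x). Qed.

Lemma ts_mulNl x y : (- x) * y = - (x * y).
Proof. by rewrite /ts_opp mulgA. Qed.

Lemma ts_oppK x : - (- x) = x.
Proof. by rewrite /ts_opp mulgA ts_negone_sq mul1g. Qed.

Lemma ts_opp0 : - 0 = 0 :> G.
Proof. exact: ts_mul0. Qed.

End TernarySemigroupTheory.

(** * Transversal representation and idempotents in a real semigroup *)

Section RealSemigroupTheory.
Local Open Scope group_scope.
Local Open Scope ts_scope.
Context {G : rsType}.
Implicit Types (a b c d e x y z s t : G) (T : set G).
Local Notation D := (@rs_rep G).
Local Notation Dt := (Defs.transversal (@rs_rep G)).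

Lemma transversalC {a b c} : Dt a b c -> Dt b a c.
Proof. by case=> h1 h2 h3; split; apply/rs0. Qed.

Lemma transversal_rot {a b c} : Dt b c a -> Dt (- a) c (- b).
Proof. by case=> h1 h2 /rs0 h3; split; rewrite ?ts_oppK. Qed.

Lemma transversalM d {a b c} : Dt b c a -> Dt (b * d) (c * d) (a * d).
Proof.
by case=> h1 h2 h3; split; rewrite -?ts_mulNl; exact: rs2.
Qed.

Lemma transversalN {a b c} : Dt b c a -> Dt (- b) (- c) (- a).
Proof.
by move/(transversalM (-1)); rewrite -!(ts_mulC (-1)).
Qed.

Lemma transversal_sub {a b c} : Dt b c a -> Dt a (- c) b.
Proof. by move/transversal_rot/transversalN; rewrite !ts_oppK. Qed.

Lemma rep_transversal {a b c} : D a b c -> Dt (c * c * a) (c * c * b) c.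
Proof. exact: rs6. Qed.

Lemma transversal_refl {a b} : b = a * a * b -> Dt a b a.
Proof.
move=> e; have := rep_transversal (rs1 a b).
by rewrite ts_cubeE -e.
Qed.

(** RS4 replaces the two squares by 1 and RS6 puts [c] in D^t(c^2, c^2); then [c] itself is the
    common element that RS7 asks for in the pair c, c^2. *)
Lemma rep_squares {a b c} : D (a * a) (b * b) c -> c = c * c.
Proof.
move=> h; have {}h : D 1 1 c by apply: (@rs4 _ _ _ a b); rewrite !mulg1.
move/rep_transversal: h; rewrite !mulg1 => h.
apply: rs7; exists c; split.
  by apply: transversal_refl; rewrite ts_mulN ts_sq_idem.
have := transversalM (- c) (transversal_rot h).
by rewrite !(ts_mulN, ts_mulNl) ts_cubeE !ts_oppK.
Qed.

Lemma rep_idem {a b c} : a * a = a -> b * b = b -> D a b c -> c * c = c.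
Proof. by move=> <- <- /rep_squares. Qed.

Lemma transversal_idem {s c} : s * s = s -> Dt s s c -> c = s.
Proof.
move=> ss h; have sc : s * c = c.
  by case: h => h _ _; rewrite -[RHS]mul1g; apply: (rs5 _ _ _ _ _ _ _ h);
    rewrite mul1g.
apply: rs7; exists s; split.
  exact: transversal_sub.
by apply: transversal_refl; rewrite ts_mulN ss sc.
Qed.

(** After multiplication by [s * i], [transversal_idem] shows that [c] fixes [s * i]. Since [s] lies
    in D(c, - s i) and [c] fixes both arguments, RS5 gives c s = s, whereas also s c = c. *)
Lemma transversal_idemM {s i c} :
  s * s = s -> i * i = i -> Dt s (s * i) c -> c = s.
Proof.
move=> ss ii h.
have si : s * i * (s * i) = s * i by rewrite (AC (2*2) ((1*3)*(2*4)))%AC /= ss ii.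
have cc : c * c = c by case: h => /(rep_idem ss si).
have sc : s * c = c.
  by case: h => h _ _; rewrite -[RHS]mul1g; apply: (rs5 _ _ _ _ _ _ _ h);
    rewrite mul1g // mulgA ss.
have csi : c * (s * i) = s * i.
  apply: (@transversal_idem (s * i)) => //.
  by have := transversalM (s * i) h; rewrite mulgA ss si.
have [h' _ _] := transversal_sub h.
have := rs5 1 c _ _ _ _ _ h'.
by rewrite !mul1g !ts_mulN csi cc (ts_mulC c s) sc; move/(_ erefl erefl).
Qed.

(** * Saturated sets and the adjunction of an element *)

Definition saturated T :=
  [/\ forall x, T (x * x), forall x y, T x -> T y -> T (x * y)
    & forall a b c, T a -> T b -> D a b c -> T c].

Lemma saturated0 {T} : saturated T -> T 0.
Proof. by case=> h _ _; rewrite -(ts_mul0 0). Qed.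

Lemma saturated1 {T} : saturated T -> T 1.
Proof. by case=> h _ _; rewrite -(mulg1 1). Qed.

Lemma saturated_idem : saturated [set x | x * x = x].
Proof.
split=> /= [x|x y xx yy|a b c]; [exact: ts_sq_idem| |exact: rep_idem].
by rewrite (AC (2*2) ((1*3)*(2*4)))%AC /= xx yy.
Qed.

(** The analogue of T + T x, with D^t in the role of addition. *)
Definition adjoin T x : set G :=
  [set y | exists s t, [/\ T s, T t & Dt s (t * x) y]].

(** x^2 acts as the identity on both arguments, hence on [v] by RS5; so [v] is the multiple (v x) x
    of [x]. *)
Lemma transversal_scaled {b c x v} : Dt (b * x) (c * x) v -> v = v * x * x.
Proof.
case=> h _ _; rewrite (ACl ((2*3)*1))%AC /= -[LHS]mul1g.
by apply: (rs5 _ _ _ _ _ _ _ h); rewrite mul1g (AC (2*2) (3*((1*2)*4)))%AC /= ts_cubeE.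
Qed.

Section Adjoin.
Variables (T : set G) (x : G).
Hypothesis satT : saturated T.

(** Three uses of RS3 regroup (s + t x) + (s' + t' x) as (s + s') + (t x + t' x). *)
Lemma adjoin_sum y y' z : adjoin T x y -> adjoin T x y' -> Dt y y' z ->
  adjoin T x z.
Proof.
have [Tsq TM TD] := satT.
move=> [s [t [Ts Tt hy]]] [s' [t' [Ts' Tt' hy']]] /transversalC hz.
have [x1 /transversalC hx1 hz1] := rs3 _ _ _ _ _ hz hy.
have [u hu hx1u] := rs3 _ _ _ _ _ hx1 hy'.
have [v hv hzv] := rs3 _ _ _ _ _ (transversalC hz1) (transversalC hx1u).
(* The coefficient v x lies in [T], being represented by t x^2 and t' x^2. *)
exists u, (v * x); split.
- by case: hu => hu _ _; exact: TD hu.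
- have [h _ _] := transversalM x hv.
  by apply: TD h; rewrite -mulgA; exact: TM.
- by rewrite -(transversal_scaled hv); exact: transversalC.
Qed.

Lemma adjoin_sub : T `<=` adjoin T x.
Proof.
move=> s Ts; exists s, 0; split=> //; first exact: saturated0.
by rewrite ts_0mul; apply: transversal_refl; rewrite ts_mul0.
Qed.

Lemma adjoin_gen : adjoin T x x.
Proof.
exists 0, 1; split; [exact: saturated0|exact: saturated1|].
by rewrite mul1g; apply/transversalC/transversal_refl; rewrite ts_mul0.
Qed.

Lemma saturated_adjoin : saturated (adjoin T x).
Proof.
have [Tsq TM TD] := satT; split.
- by move=> y; exact/adjoin_sub/Tsq.
- move=> y z [s [t [Ts Tt hy]]] [s' [t' [Ts' Tt' hz]]].
  (* With y = s + t x, the product y z is split as s z + t x z. *)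
  apply: (@adjoin_sum (s * z) (t * x * z)); last exact: transversalM.
    exists (s * s'), (s * t'); split; [exact: TM|exact: TM|].
    by have := transversalM s hz; rewrite -!(ts_mulC s) mulgA.
  exists (t * t' * (x * x)), (t * s'); split; [by apply: (TM) => //; exact: TM|exact: TM|].
  have := transversalM (t * x) hz; rewrite -!(ts_mulC (t * x)) => /transversalC.
  by rewrite [X in Dt X](AC (2*2) ((1*3)*(2*4)))%AC /= [X in Dt _ X](ACl ((1*3)*2))%AC.
(* RS6 gives a transversal relation only between z^2 y and z^2 y'; the factor z^2 is absorbed into
   the coefficients, since [T] contains the squares. *)
- move=> y y' z [s [t [Ts Tt hy]]] [s' [t' [Ts' Tt' hy']]] /rep_transversal.
  have sq p q r : T p -> T q -> Dt p (q * x) r -> adjoin T x (z * z * r).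
    move=> Tp Tq /(transversalM (z * z)); rewrite -!(ts_mulC (z * z)) => h.
    by exists (z * z * p), (z * z * q); split;
      [by apply: (TM)|by apply: (TM)|by rewrite -[z * z * q * x]mulgA].
  by apply: adjoin_sum; [exact: sq hy|exact: sq hy'].
Qed.

End Adjoin.

Lemma saturated_opp {T} x y : saturated T -> T (- x) -> T y -> T (- (x * y)).
Proof. by case=> _ TM _ Tx Ty; rewrite -ts_mulNl; exact: TM. Qed.

(* In ring notation: from - s = p + t u and - s = p' + t' v with s = s^2,
   multiplying out gives - s = s p + s p' + p p' + t t' (- u v). *)
Lemma adjoin_opp_mul {T s u v} : saturated T -> s * s = s -> T (- (u * v)) ->
  adjoin T u (- s) -> adjoin T v (- s) -> T (- s).
Proof.
move=> satT ss Tuv hu hv; have [Tsq TM TD] := satT.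
have Ts : T s by rewrite -ss.
have key w : adjoin T w (- s) ->
    exists p t, [/\ T p, T t & Dt s (s * p) (- (s * t * w))].
  move=> [p [t [Tp Tt h]]]; exists p, t; split=> //.
  have := transversal_rot (transversalC (transversalM s h)).
  by rewrite ts_mulNl ss ts_oppK (ts_mulC p) (ts_mulC _ s) mulgA.
have [p [t [Tp Tt hy]]] := key _ hu.
have [p' [t' [Tp' Tt' hz]]] := key _ hv.
set y := - _ in hy; set z := - _ in hz.
have sz : s * z = z by rewrite /z ts_mulN !mulgA ss.
have Tz : T z by case: hz => h _ _; apply: TD h => //; exact: TM.
have hyz := transversalC (transversalM z hy).
rewrite sz in hyz.
have [w [hw _ _] /transversalC/transversal_rot[h _ _]] :=
  rs3 _ _ _ _ _ hyz (transversalC hz).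
apply: (TD _ _ _ _ _ h).
  rewrite /y /z ts_mulN ts_mulNl ts_oppK (AC (3*3) ((1*2*4*5)*(3*6)))%AC /=.
  by rewrite -ts_mulN; do 4?[apply: (TM) => //].
by apply: (TD _ _ _ _ _ hw); do 2?[apply: (TM) => //].
Qed.

(** * Characters from maximal saturated sets, and separation of points *)

Lemma exists_maximal_saturated {T0 s} : saturated T0 -> ~ T0 (- s) ->
  exists T, [/\ saturated T, T0 `<=` T, ~ T (- s)
               & forall x, ~ T x -> adjoin T x (- s)].
Proof.
move=> sat0 s0.
pose P X := X = set0 \/ [/\ saturated X, T0 `<=` X & ~ X (- s)].
have [A [PA maxA]] : exists A, P A /\ forall B, A `<` B -> ~ P B.
  apply: Zorn_bigcup => F FP totF.
  have [[X0 FX0 [x0 Xx0]]|F0] := pselect (exists2 X, F X & X !=set0); last first.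
    left; apply/seteqP; split=> // x [X FX Xx].
    by case: F0; exists X => //; exists x.
  have good X x : F X -> X x -> [/\ saturated X, T0 `<=` X & ~ X (- s)].
    by move=> FX Xx; case: (FP _ FX) => // X0'; rewrite X0' in Xx.
  have [[Xsq _ _] TX0 _] := good _ _ FX0 Xx0.
  have join X Y x y : F X -> F Y -> X x -> Y y ->
      exists Z, [/\ F Z, saturated Z, Z x & Z y].
    move=> FX FY Xx Yy; have [satX _ _] := good _ _ FX Xx.
    have [satY _ _] := good _ _ FY Yy.
    case: (totF _ _ FX FY) => XY; [exists Y|exists X]; split=> //; exact: XY.
  right; split.
  - split=> [x|x y [X FX Xx] [Y FY Yy]|a b c [X FX Xa] [Y FY Yb] h].
    + by exists X0.
    + have [Z [FZ [_ ZM _] Zx Zy]] := join _ _ _ _ FX FY Xx Yy.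
      by exists Z => //; exact: ZM.
    + have [Z [FZ [_ _ ZD] Za Zb]] := join _ _ _ _ FX FY Xa Yb.
      by exists Z => //; exact: ZD h.
  - by move=> x /TX0 X0x; exists X0.
  - by move=> [X FX Xs]; have [_ _ []] := good _ _ FX Xs.
case: PA => [A0|[satA T0A sA]].
  have AT0 : A `<` T0 by rewrite A0; split=> // /(_ 0 (saturated0 sat0)).
  by case: (maxA _ AT0); right; split.
exists A; split=> // x xA; apply: contrapT => sAx.
have AAx : A `<` adjoin A x.
  by split; [exact: adjoin_sub|move/(_ x (adjoin_gen _ x satA))].
case: (maxA _ AAx); right; split=> //; first exact: saturated_adjoin.
by move=> y /T0A; exact: adjoin_sub.
Qed.

(** When every element or its opposite lies in [T], as for the maximal sets below, this is the sign
    for an ordering with support T ∩ -T. *)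
Definition sign_of T x : three :=
  if `[< T (- x) >] then (if `[< T x >] then Zero else NegOne) else One.

Lemma exists_character {T0 s} : s * s = s -> saturated T0 -> ~ T0 (- s) ->
  exists h, [/\ characters G h, h s = 1 & forall x, T0 x -> h x <> -1].
Proof.
move=> ss sat0 s0.
have [T [satT T0T sT maxT]] := exists_maximal_saturated sat0 s0.
have [Tsq TM TD] := satT.
(* Were both outside [T], adjoining either would produce - s by maximality, and [adjoin_opp_mul]
   would put - s in [T]. *)
have prime u v : T (- (u * v)) -> T u \/ T v.
  move=> Tuv; apply: contrapT => /not_orP[/maxT hu /maxT hv].
  exact/sT/(adjoin_opp_mul satT ss Tuv hu hv).
(* Primality applies because - (x (- x)) = x^2 lies in [T]. *)
have total x : ~ T (- x) -> T x.
  by move=> Tx; case: (prime x (- x)) => //; rewrite ts_mulN ts_oppK.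
have Ts : T s by rewrite -ss.
have N1 : ~ T (-1).
  by move=> /(TM s _ Ts); rewrite ts_mulC.
have opp1 : ts_opp 1 = -1 :> G by rewrite /ts_opp mulg1.
have sgn0 x : T x -> T (- x) -> sign_of T x = Zero.
  by move=> Tx Tnx; rewrite /sign_of !asboolT.
have sgn1 x : ~ T (- x) -> sign_of T x = One.
  by move=> Tnx; rewrite /sign_of asboolF.
have sgnN1 x : ~ T x -> sign_of T x = NegOne.
  move=> Tx; rewrite /sign_of asboolT ?asboolF //.
  by apply: contrapT => /total.
have mul0 x y : T x -> T (- x) -> sign_of T (x * y) = Zero.
  move=> Tx Tnx; have [Ty|/total Ty] := lem (T (- y)).
    apply: sgn0; last by rewrite -ts_mulN; exact: TM.
    by rewrite -[_ * _]ts_oppK -(ts_mulN x y); exact: saturated_opp.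
  by apply: sgn0; [exact: TM|exact: saturated_opp].
have mul1 x y : ~ T (- x) -> sign_of T (x * y) = sign_of T y.
  move=> Tnx; have [Tny|Tny] := lem (T (- y)); last first.
    rewrite !sgn1 // => Txy; case: (prime (- x) (- y)) => //.
    by rewrite ts_mulN ts_mulNl ts_oppK.
  have [Ty|Ty] := lem (T y); first by rewrite ts_mulC mul0 // sgn0.
  rewrite !sgnN1 // => Txy; case: (prime (- x) y) => //.
  by rewrite ts_mulNl ts_oppK.
have sgnopp x : sign_of T (- x) = NegOne * sign_of T x.
  rewrite /sign_of ts_oppK; case: asboolP => [_|/sgnN1]; case: asboolP => //.
  by move=> Tnx; rewrite sgn1.
exists (sign_of T); split; last 2 first.
- exact: sgn1.
- by move=> x /T0T Tx; rewrite /sign_of (asboolT Tx); case: ifP.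
split.
- move=> x y; have [Tnx|Tnx] := lem (T (- x)); last first.
    by rewrite mul1 // (sgn1 x) //; case: sign_of.
  have [Tx|Tx] := lem (T x); first by rewrite mul0 // (sgn0 x).
  rewrite (sgnN1 _ Tx) -sgnopp -[x]ts_oppK ts_mulNl -ts_mulN mul1 //.
  by rewrite ts_oppK.
- by apply: sgn1; rewrite opp1.
- by apply: sgn0; rewrite ?ts_opp0; exact: saturated0.
- exact: sgnN1.
(* For [c] strictly positive, saturation applied to - a, - b, - c forbids that both - a and - b lie
   in [T]; the negative case is the same with a, b, c. *)
- move=> a b c h; have [Tnc|Tnc] := lem (T (- c)); last first.
    have [Ta|/sgn1 ->] := lem (T (- a)); last by rewrite (sgn1 _ Tnc); exact: Or32.
    have [Tb|/sgn1 ->] := lem (T (- b)); last by rewrite (sgn1 _ Tnc); exact: Or33.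
    case: Tnc; apply: TD Ta Tb _.
    by have := rs2 _ _ _ (-1) h; rewrite -!(ts_mulC (-1)).
  have [Tc|Tc] := lem (T c); first by rewrite sgn0 //; exact: Or31.
  have [Ta|/sgnN1 ->] := lem (T a); last by rewrite (sgnN1 _ Tc); exact: Or32.
  have [Tb|/sgnN1 ->] := lem (T b); last by rewrite (sgnN1 _ Tc); exact: Or33.
  by case: Tc; exact: TD h.
Qed.

(** Adjoin - q to the idempotents. If - s = i - j q were there, multiplying by [s] would put j s q
    in D^t(s, s i), whose only element is [s]. *)
Lemma exists_character_le {s q} : s * s = s ->
  (forall j, j * j = j -> s <> j * s * q) ->
  exists h, [/\ characters G h, h s = 1 & h q <> 1].
Proof.
move=> ss hj.
have satA := saturated_adjoin _ (- q) saturated_idem.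
have [|h [hc hs hT]] := exists_character ss satA.
  move=> [i [j /= [ii jj h]]]; apply: (hj j jj); symmetry.
  have := transversal_rot (transversalC (transversalM s h)).
  rewrite ts_mulN !ts_mulNl !ts_oppK ss (ts_mulC i) => /(transversal_idemM ss ii).
  by rewrite (ACl (1*3*2))%AC.
exists h; split=> // hq; case: hc => hM _ _ hN _.
by apply: (hT _ (adjoin_gen _ _ saturated_idem)); rewrite hM hN hq.
Qed.

(** Otherwise [exists_character_le] for a^2 and b^2 yields a character nonzero at [a] and zero at
    [b]. *)
Lemma characters_sep_sq {a b} :
  (forall h, characters G h -> h a <> 0 -> h b <> 0) -> a * a * (b * b) = a * a.
Proof.
move=> hab; apply: contrapT => ab.
have [|h [hc hs hq]] := @exists_character_le _ (b * b) (ts_sq_idem a).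
  move=> j jj e; apply: ab.
  by rewrite [X in X * _]e -mulgA ts_sq_idem -e.
have := hab _ hc; case: hc => hM _ _ _ _; move: hs hq; rewrite !hM.
by case: (h a) => //; case: (h b) => // _ _ /(_ _ erefl); case.
Qed.

(** The squares agree by [characters_sep_sq]; if a and b differed, [exists_character_le] for a^2 and
    a b would give a character telling them apart. *)
Lemma characters_sep {a b} : (forall h, characters G h -> h a = h b) -> a = b.
Proof.
move=> hab.
have ab1 : a * a * (b * b) = a * a.
  by apply: characters_sep_sq => h /hab ->.
have ab2 : b * b * (a * a) = b * b.
  by apply: characters_sep_sq => h /hab ->.
have ab : a * a = b * b by rewrite -ab1 ts_mulC.
apply: contrapT => nab.
have [|h [hc hs hq]] := @exists_character_le _ (a * b) (ts_sq_idem a).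
  (* Multiplying a^2 = j a b by a b gives a b = j a^2 = a^2, whence a = a^2 b = b^3 = b. *)
  move=> j jj e; apply: nab; rewrite -mulgA ts_sqK in e.
  have jaa : j * (a * a) = a * a by rewrite e mulgA jj.
  have aab : a * b = a * a.
    have abab : a * b * (a * b) = a * a.
      by rewrite (AC (2*2) ((1*3)*(2*4)))%AC /= ab1.
    by rewrite -ts_sqK {1}e -mulgA abab.
  by rewrite -[LHS]ts_cubeE -mulgA -aab mulgA ab ts_cubeE.
have ehab := hab _ hc; case: hc => hM _ _ _ _; move: hs hq.
by rewrite !hM -ehab; case: (h a).
Qed.

End RealSemigroupTheory.

(** * Ideals, representation and characters in a fan *)

Section Fan.
Local Open Scope group_scope.
Local Open Scope ts_scope.
Context {F : rsType}.
Hypothesis fanF : is_fan F.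
Implicit Types (a b c x y : F) (I J : Spec F).
Local Notation Dt := (Defs.transversal (@rs_rep F)).

(** In ring notation a = a + (b - b) = (a + b) - b, by RS3. *)
Lemma transversal_inhabited a b : exists c, Dt a b c.
Proof.
have ha : Dt a 0 a by apply: transversal_refl; rewrite ts_mul0.
have hb : Dt b (- b) 0.
  by apply: transversal_sub; apply/transversalC/transversal_refl; rewrite ts_mul0.
by have [c hc _] := rs3 _ _ _ _ _ ha hb; exists c.
Qed.

Lemma character_transversal {h a b c} : characters F h -> Dt a b c ->
  (h a = 0 -> h c = h b) /\ (h b = 0 -> h c = h a).
Proof.
move=> [hM _ _ hN hD].
have hopp x : h (- x) = NegOne * h x by rewrite /ts_opp hM hN.
case=> /hD + /hD + /hD; rewrite !hopp.
case: (h a); case: (h b); case: (h c);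
  by do 3![case=> // _].
Qed.

(* For z in D^t(x^2, - y^2) the character h1 * h2^2 would vanish at x and y but
   not at z. *)
Lemma fan_zeros_total {h1 h2 x y} : characters F h1 -> characters F h2 ->
  h1 x = 0 -> h1 y <> 0 -> h2 x <> 0 -> h2 y = 0 -> False.
Proof.
move=> c1 c2 h1x h1y h2x h2y.
have [z hz] := transversal_inhabited (x * x) (- (y * y)).
have [[M1 _ _ N1 _] [M2 _ _ N2 _]] := (c1, c2).
have [+ _] := character_transversal c1 hz.
have [_ +] := character_transversal c2 hz.
have [+ _] := character_transversal (fanF _ _ _ c1 c2 c2) hz.
rewrite /ts_opp !M1 !M2 N1 N2 h1x h2y.
move: h1y h2x.
by case: (h1 y); case: (h2 x); case: (h1 z); case: (h2 z) => // _ _ H1 H2 H3;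
  move: (H1 erefl) (H2 erefl) (H3 erefl).
Qed.

(** Failure of both alternatives would give two characters with crossed zeros at [x] and [y]. *)
Lemma fan_sq_total x y : x * x * (y * y) = x * x \/ y * y * (x * x) = y * y.
Proof.
have [hxy|] := pselect (forall h, characters F h -> h x <> 0 -> h y <> 0).
  by left; exact: characters_sep_sq.
have [hyx|] := pselect (forall h, characters F h -> h y <> 0 -> h x <> 0).
  by right; exact: characters_sep_sq.
move=> /existsNP[h1 /not_implyP[c1 /not_implyP[h1y /contrapT h1x]]].
move=> /existsNP[h2 /not_implyP[c2 /not_implyP[h2x /contrapT h2y]]].
by case: (fan_zeros_total c1 c2 h1x h1y h2x h2y).
Qed.

(** If x^2 = x^2 y^2 then x = x^3 is a multiple of x y, and symmetrically for [y]. *)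
Lemma fan_spec_prime {J x y} : sval J (x * y) -> sval J x \/ sval J y.
Proof.
move=> Jxy; case: (fan_sq_total x y) => e; [left|right].
  rewrite -[x]ts_cubeE -e (AC (2*2*1) ((1*2*3)*(5*4)))%AC.
  exact: spec_ideal.
rewrite -[y]ts_cubeE -e (AC (2*2*1) ((1*2*3)*(4*5)))%AC.
exact: spec_ideal.
Qed.

(* If none of the alternatives held, the product of three characters violating
   them would take at c a nonzero value differing from those at a and b. *)
Lemma fan_rep_cases {a b c} : rs_rep a b c ->
  [\/ c = c * c * a, c = c * c * b
     | c * a = - (c * b) /\ c = a * a * c].
Proof.
move=> h; apply: contrapT => nabc.
have ha : c <> c * c * a by move=> e; apply: nabc; exact: Or31.
have hb : c <> c * c * b by move=> e; apply: nabc; exact: Or32.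
have hab : ~ (c * a = - (c * b) /\ c = a * a * c).
  by move=> e; apply: nabc; exact: Or33.
have sep (u v : F) : u <> v -> exists2 h, characters F h & h u <> h v.
  move=> uv; apply: contrapT => nh; apply: uv; apply: characters_sep => k kF.
  by apply: contrapT => kuv; apply: nh; exists k.
have [h1 c1 n1] := sep _ _ ha.
have [h2 c2 n2] := sep _ _ hb.
have [h3 [c3 n3]] : exists h3, characters F h3 /\
    (h3 (c * a) <> h3 (- (c * b)) \/ h3 c <> h3 (a * a * c)).
  have [/sep[k kF n]|/contrapT e] := lem (c * a <> - (c * b)).
    by exists k; split=> //; left.
  have [/sep[k kF n]|/contrapT e'] := lem (c <> a * a * c).
    by exists k; split=> //; right.
  by case: hab.
case: (fanF _ _ _ c1 c2 c3) => _ _ _ _ /(_ _ _ _ h).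
have [[M1 _ _ _ D1] [M2 _ _ _ D2] [M3 _ _ N3 D3]] := And3 c1 c2 c3.
move: {D1 D2 D3}(D1 _ _ _ h) (D2 _ _ _ h) (D3 _ _ _ h) n1 n2 n3.
rewrite /ts_opp !M1 !M2 !M3 N3.
case: (h1 a); case: (h1 b); case: (h1 c) => d1; try by [case: d1];
case: (h2 a); case: (h2 b); case: (h2 c) => d2; try by [case: d2];
case: (h3 a); case: (h3 b); case: (h3 c) => d3 n1 n2 n3; try by [case: d3|case: n3];
by case.
Qed.

(** Each case of [fan_rep_cases] consists of equations in products and -1; [h] preserves them, and
    in [three] they force the condition on representation. *)
Lemma fan_hom_character (h : F -> three) :
  (forall a b, h (a * b) = h a * h b) -> h 1 = 1 -> h 0 = 0 -> h (-1) = -1 ->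
  characters F h.
Proof.
move=> hM h1 h0 hN; split=> // a b c /fan_rep_cases.
case=> [/(congr1 h)|/(congr1 h)|[/(congr1 h) + /(congr1 h)]];
  rewrite /ts_opp !hM ?hN; case: (h a); case: (h b); case: (h c) => // *;
  first [exact: Or31|exact: Or32|exact: Or33].
Qed.

(** * Truncation of a character at an ideal, and specialization *)

Definition truncate J (g : F -> three) x : three :=
  if `[< sval J x >] then Zero else g x.

(** Primality of [J] makes the truncation multiplicative; [fan_hom_character] supplies the rest. *)
Lemma level_truncate {I J g} : sval I `<=` sval J -> level I g ->
  level J (truncate J g).
Proof.
move=> IJ gI; have [[gM g1 g0 gN _] gZ] := gI.
have J0 : sval J 0.
  by apply: IJ; rewrite -gZ.
split; last first.
  apply/seteqP; split=> x; rewrite /zero_set /= /truncate.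
    by case: asboolP => // _ gx; apply: IJ; rewrite -gZ.
  by move=> Jx; rewrite asboolT.
apply: fan_hom_character.
- move=> a b; rewrite /truncate; case: (asboolP (sval J a)) => Ja.
    by rewrite asboolT // ts_mulC; exact: spec_ideal.
  case: (asboolP (sval J b)) => Jb.
    by rewrite asboolT ?ts_mul0 //; exact: spec_ideal.
  by rewrite asboolF // => /fan_spec_prime[].
- by rewrite /truncate asboolF //; exact: spec1N.
- by rewrite /truncate asboolT.
- by rewrite /truncate asboolF //; exact: spec_negoneN.
Qed.

Lemma specializes_truncate {J g} : g ~~> truncate J g.
Proof. by move=> x /=; rewrite /truncate; case: ifP. Qed.

Lemma specializesE {g h x} : characters F g -> characters F h ->
  g ~~> h -> h x <> 0 -> h x = g x.
Proof.
move=> [gM _ _ gN _] [hM _ _ hN _] gh.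
(* Specialization at [x] settles h x = 1, and at - x it settles h x = -1. *)
have := gh x; have := gh (-1 * x); rewrite /= gM hM gN hN.
by case: (h x); case: (g x) => // h1 h2;
  first [by have := h1 erefl|by have := h2 erefl].
Qed.

Lemma level_specializes_unique {I J g h} : level I g -> level J h -> g ~~> h ->
  truncate J g = h.
Proof.
move=> [gF _] [hF hJ] gh; apply/funext => x; rewrite /truncate -hJ.
case: asboolP => [->//|hx]; symmetry; exact: specializesE.
Qed.

End Fan.

Theorem proposition1p2 (F : rsType) (FF : is_fan F) (I J : Spec F)
    (IJ : sval I `<=` sval J) :
  (exists iota : level_group J -> level_group I,
     (forall a (aJ : ~ sval J a),
        iota (level_inj aJ) = level_inj (contra_not (@IJ a) aJ))
     /\ sg_homomorphism iota)
  /\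
  (exists kappa : level I -> level J,
     (forall g, unique (fun h : level J => sval g ~~> sval h) (kappa g))
     /\ aos_morphism (S := level_space I) (T := level_space J) kappa).
Proof.
pose kappa (g : level I) : level J :=
  SigSub (mem_set (level_truncate FF IJ (set_mem (svalP g)))).
(* [iota] is defined on a chosen representative; independence of the choice comes later, from the
   signs separating the classes. *)
pose iota (x : level_group J) : level_group I :=
  level_inj (contra_not (@IJ (level_repr x)) (@level_reprN _ J x)).
(* [kappa] and [iota] are dual to each other: this identity is the morphism property of [kappa], and
   it reduces every claim on [iota] to signs. *)
have kappa_sign g x : level_sign (kappa g) x = level_sign g (iota x).
  rewrite level_signE /level_sign /= /truncate asboolF //.
  exact: level_reprN.
have iotaM x y : iota (x * y)%g = (iota x * iota y)%g.
  apply: level_sign_sep => g.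
  by rewrite level_sign_mul -!kappa_sign level_sign_mul.
have iotaN1 : iota sg_negone = sg_negone.
  by apply: level_sign_sep => g; rewrite -kappa_sign !level_sign_negone.
split.
  exists iota; split=> [a aJ|].
    apply: level_sign_sep => g.
    by rewrite -kappa_sign !level_signE /= /truncate asboolF.
  split=> // x y z xyz nxy.
  (* If y = - x, then [iota y] is - [iota x], contrary to [nxy]; otherwise [z] is x or y. *)
  by case: xyz => [yx|->|->]; [case: nxy; rewrite yx iotaM iotaN1|left|right].
exists kappa; split=> [g|x].
  split=> [|h gh]; first exact: specializes_truncate.
  apply/val_inj; apply: level_specializes_unique gh.
    exact: set_mem (svalP g).
  exact: set_mem (svalP h).
by exists (iota x) => g; exact: kappa_sign.
Qed.
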